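(* Let $n\in\mathbb{N}^*$, $\alpha_1,\dots,\alpha_n\ge0$ and $0\le\rho_1<\dots<\rho_n$. Let $T>0$, $N\in\mathbb{N}^*$ and $t_k=kT/N$. (a) Assume $G_1(t)=\sum_{i=1}^n\alpha_iM_1(\rho_i)e^{-\rho_it}$ and $G_2(t)=\sum_{i=1}^n\alpha_iM_2(\rho_i)e^{-\rho_it}$. Let $X^N$ be the Volterra Euler scheme: $X^N_{t_0}=x_0$ and, for $0\le k\le N-1$, $$X^N_{t_{k+1}}=x_0+\sum_{j=0}^kG_1\Big((k+1-j)\tfrac TN\Big)b(X^N_{t_j})\tfrac TN+\sum_{j=0}^kG_2\Big((k+1-j)\tfrac TN\Big)\sigma(X^N_{t_j})(W_{t_{j+1}}-W_{t_j}).$$ Let $\hat X^N$ be the multifactor Euler scheme: $\hat X^{i,N}_{t_0}=\hat Y^{i,N}_{t_0}=0$ for $1\le i\le n$, for $0\le k\le N-1$ $$\hat X^{i,N}_{t_{k+1}}=e^{-\rho_i\frac TN}\Big(\hat X^{i,N}_{t_k}+b(\hat X^N_{t_k})\tfrac TN\Big),\qquad \hat Y^{i,N}_{t_{k+1}}=e^{-\rho_i\frac TN}\Big(\hat Y^{i,N}_{t_k}+\sigma(\hat X^N_{t_k})(W_{t_{k+1}}-W_{t_k})\Big),$$ and, for $0\le k\le N$, $\hat X^N_{t_k}=x_0+\sum_{i=1}^n\alpha_iM_1(\rho_i)\hat X^{i,N}_{t_k}+\sum_{i=1}^n\alpha_iM_2(\rho_i)\hat Y^{i,N}_{t_k}$.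 Then $X^N_{t_k}=\hat X^N_{t_k}$ for all $k\in\{0,\dots,N\}$. (b) Assume $G_1(t)=G_2(t)=\sum_{i=1}^n\alpha_iM(\rho_i)e^{-\rho_it}$. Let $X^N$ be the Volterra Euler scheme defined as in the display of part (a) with these kernels, and let $\hat X^N$ be now defined by $\hat X^{i,N}_{t_0}=0$ for $1\le i\le n$, for $0\le k\le N-1$ $$\hat X^{i,N}_{t_{k+1}}=e^{-\rho_i\frac TN}\Big(\hat X^{i,N}_{t_k}+b(\hat X^N_{t_k})\tfrac TN+\sigma(\hat X^N_{t_k})(W_{t_{k+1}}-W_{t_k})\Big),$$ and, for $0\le k\le N$, $\hat X^N_{t_k}=x_0+\sum_{i=1}^n\alpha_iM(\rho_i)\hat X^{i,N}_{t_k}$. Then $X^N_{t_k}=\hat X^N_{t_k}$ for all $k\in\{0,\dots,N\}$.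
   Context: $d\ge1$, $x_0\in\mathbb{R}^d$, $W$ is a standard $d$-dimensional Brownian motion, $\mathcal{M}_d(\mathbb{R})$ is the space of real $d\times d$ matrices, $b:\mathbb{R}^d\to\mathbb{R}^d$ and $\sigma:\mathbb{R}^d\to\mathcal{M}_d(\mathbb{R})$ are globally Lipschitz, and $M_1,M_2,M:\mathbb{R}_+\to\mathcal{M}_d(\mathbb{R})$ are bounded measurable functions. *)

(* Defs.v *)
From HB Require Import structures.
From mathcomp Require Export all_boot all_order all_algebra.
From mathcomp Require Export all_classical all_reals all_analysis.
Export numFieldNormedType.Exports.

Set Implicit Arguments.
Unset Strict Implicit.
Unset Printing Implicit Defensive.

Import Order.TTheory GRing.Theory Num.Theory.

Local Open Scope classical_set_scope.
Local Open Scope ring_scope.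

(* Vectors of R^d are column vectors.  Functions of a time t in R_+ are
   functions on R of which only the values at t >= 0 are constrained. *)

(* The product rule over the whole finite family gives the one over each
   subfamily: take A i := setT outside it. *)
Definition independent_rvs (R : realType) (disp : measure_display)
    (Omega : measurableType disp) (P : probability Omega R)
    (I : finType) (Y : I -> Omega -> R) : Prop :=
  forall A : I -> set R, (forall i, measurable (A i)) ->
    P (\bigcap_i (Y i @^-1` A i)) = (\prod_i P (Y i @^-1` A i))%E.

(* The fourth clause takes the increments jointly with their coordinates:
   together with the last clause, it says that the increments over disjoint
   intervals are independent and that W t - W s has law N(0, (t - s) I_d). *)
Definition brownian_motion (R : realType) (disp : measure_display)
    (Omega : measurableType disp) (P : probability Omega R)
    (d : nat) (W : R -> Omega -> 'cV[R]_d) : Prop :=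
  [/\ (forall t, 0 <= t -> forall i,
         measurable_fun [set: Omega] (fun w => W t w i ord0)),
      {ae P, forall w, W 0 w = 0},
      {ae P, forall w, {within `[0, +oo[, continuous (fun t => W t w)}},
      (forall (m : nat) (t : nat -> R),
         0 <= t 0%N -> (forall j, t j <= t j.+1) ->
         independent_rvs P (fun (ji : 'I_m * 'I_d) w =>
           (W (t ji.1.+1) w - W (t ji.1) w) ji.2 ord0)) &
      (forall s t : R, 0 <= s -> s < t ->
         forall (i : 'I_d) (A : set R), measurable A ->
         P [set w | A ((W t w - W s w) i ord0)] =
         normal_prob 0 (Num.sqrt (t - s)) A)].

Definition bounded_measurable (R : realType) (d : nat)
    (M : R -> 'M[R]_d) : Prop :=
  [bounded M t | t in `[0, +oo[] /\
  forall i j, measurable_fun (`[0, +oo[ : set R) (fun t => M t i j).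

Definition exp_sum_kernel (R : realType) (d n : nat) (alpha rho : 'I_n -> R)
    (M : R -> 'M[R]_d) (t : R) : 'M[R]_d :=
  \sum_i (alpha i * expR (- (rho i * t))) *: M (rho i).

Definition grid_time (R : realType) (T : R) (N k : nat) : R :=
  k%:R * T / N%:R.

Definition grid_increment (R : realType) (Omega : Type) (d : nat) (T : R)
    (N : nat) (W : R -> Omega -> 'cV[R]_d) (k : nat) (w : Omega) : 'cV[R]_d :=
  W (grid_time T N k.+1) w - W (grid_time T N k) w.

(* In the schemes below, a process sampled on the grid is indexed by k, for the
   time t_k; nothing is required of it at k > N. *)

Definition volterra_euler (R : realType) (Omega : Type) (d : nat)
    (x0 : 'cV[R]_d) (b : 'cV[R]_d -> 'cV[R]_d) (sigma : 'cV[R]_d -> 'M[R]_d)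
    (W : R -> Omega -> 'cV[R]_d) (T : R) (N : nat) (G1 G2 : R -> 'M[R]_d)
    (X : nat -> Omega -> 'cV[R]_d) : Prop :=
  (forall w, X 0%N w = x0) /\
  forall k, (k < N)%N -> forall w,
    X k.+1 w = x0
      + \sum_(j < k.+1) (T / N%:R) *:
          (G1 ((k.+1 - j)%:R * (T / N%:R)) *m b (X j w))
      + \sum_(j < k.+1) G2 ((k.+1 - j)%:R * (T / N%:R)) *m sigma (X j w)
          *m grid_increment T N W j w.

Definition multifactor_euler (R : realType) (Omega : Type) (d n : nat)
    (x0 : 'cV[R]_d) (b : 'cV[R]_d -> 'cV[R]_d) (sigma : 'cV[R]_d -> 'M[R]_d)
    (W : R -> Omega -> 'cV[R]_d) (T : R) (N : nat) (alpha rho : 'I_n -> R)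
    (M1 M2 : R -> 'M[R]_d) (Xf Yf : 'I_n -> nat -> Omega -> 'cV[R]_d)
    (X : nat -> Omega -> 'cV[R]_d) : Prop :=
  [/\ (forall i w, Xf i 0%N w = 0 /\ Yf i 0%N w = 0),
      (forall k, (k < N)%N -> forall i w,
         Xf i k.+1 w = expR (- (rho i * (T / N%:R))) *:
           (Xf i k w + (T / N%:R) *: b (X k w))),
      (forall k, (k < N)%N -> forall i w,
         Yf i k.+1 w = expR (- (rho i * (T / N%:R))) *:
           (Yf i k w + sigma (X k w) *m grid_increment T N W k w)) &
      (forall k, (k <= N)%N -> forall w,
         X k w = x0 + \sum_i alpha i *: (M1 (rho i) *m Xf i k w)
                    + \sum_i alpha i *: (M2 (rho i) *m Yf i k w))].

Definition multifactor_euler_common (R : realType) (Omega : Type) (d n : nat)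
    (x0 : 'cV[R]_d) (b : 'cV[R]_d -> 'cV[R]_d) (sigma : 'cV[R]_d -> 'M[R]_d)
    (W : R -> Omega -> 'cV[R]_d) (T : R) (N : nat) (alpha rho : 'I_n -> R)
    (M : R -> 'M[R]_d) (Xf : 'I_n -> nat -> Omega -> 'cV[R]_d)
    (X : nat -> Omega -> 'cV[R]_d) : Prop :=
  [/\ (forall i w, Xf i 0%N w = 0),
      (forall k, (k < N)%N -> forall i w,
         Xf i k.+1 w = expR (- (rho i * (T / N%:R))) *:
           (Xf i k w + (T / N%:R) *: b (X k w)
            + sigma (X k w) *m grid_increment T N W k w)) &
      (forall k, (k <= N)%N -> forall w,
         X k w = x0 + \sum_i alpha i *: (M (rho i) *m Xf i k w))].

(* Main.v *)
Require Import Defs.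

Set Implicit Arguments.
Unset Strict Implicit.
Unset Printing Implicit Defensive.

Import Order.TTheory GRing.Theory Num.Theory.
Local Open Scope classical_set_scope.
Local Open Scope ring_scope.

(** The identity is algebraic and holds path by path.  Each factor obeys a linear
    recursion, [F (k+1) = exp (- r h) (F k + g k)] with [F 0 = 0], whose
    solution is the discrete convolution [\sum_(j < k) exp (- r (k - j) h) g j]
    because [exp] turns the product of one-step discounts into the discount
    over the whole elapsed time ([discounted_sum]).  Taking the linear
    combination of the factors with weights [alpha i *: M (rho i)] and
    exchanging the two sums rebuilds the exponential-sum kernel in front of
    each [g j] ([factor_sum_kernel]).  So either multifactor scheme is itself
    a Volterra Euler scheme ([multifactor_euler_volterra],
    [multifactor_euler_common_volterra]), and a Volterra Euler scheme is
    determined by its data, being explicit in the past values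
    ([volterra_euler_unique]). *)

(** Variation of constants in discrete time: a unit injected at step [j] is
    discounted once at each of the steps [j+1, ..., k], including the step at
    which it enters, hence the elapsed time [(k - j) h] rather than
    [(k - j - 1) h]. *)
Lemma discounted_sum (R : realType) (V : lmodType R) (r h : R) (N : nat)
    (F g : nat -> V) :
  F 0%N = 0 ->
  (forall k, (k < N)%N -> F k.+1 = expR (- (r * h)) *: (F k + g k)) ->
  forall k, (k <= N)%N ->
    F k = \sum_(j < k) expR (- (r * ((k - j)%:R * h))) *: g j.
Proof.
move=> F0 FS; elim=> [|k IHk] ltkN; first by rewrite big_ord0.
rewrite FS // big_ord_recr /= IHk 1?ltnW // scalerDr subSnn mul1r.
congr (_ + _); rewrite scaler_sumr; apply: eq_bigr => j _.
rewrite scalerA -expRD subSn 1?ltnW //; congr (expR _ *: _).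
by rewrite -natr1 mulrDl mul1r mulrDr opprD addrC.
Qed.

(** The kernel is the superposition of the factors' discounts, so exchanging
    the sum over factors with the sum over past steps makes it appear. *)
Lemma factor_sum_kernel (R : realType) (d n : nat) (alpha rho : 'I_n -> R)
    (M : R -> 'M[R]_d) (h : R) (N : nat) (F : 'I_n -> nat -> 'cV[R]_d)
    (g : nat -> 'cV[R]_d) :
  (forall i, F i 0%N = 0) ->
  (forall k, (k < N)%N -> forall i,
     F i k.+1 = expR (- (rho i * h)) *: (F i k + g k)) ->
  forall k, (k <= N)%N ->
    \sum_i alpha i *: (M (rho i) *m F i k) =
    \sum_(j < k) exp_sum_kernel alpha rho M ((k - j)%:R * h) *m g j.
Proof.
move=> F0 FS k lekN.
under [RHS]eq_bigr do rewrite mulmx_suml.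
rewrite exchange_big /=; apply: eq_bigr => i _.
rewrite (discounted_sum (F0 i) (fun k ltkN => FS k ltkN i) lekN).
rewrite mulmx_sumr scaler_sumr; apply: eq_bigr => j _.
by rewrite -scalemxAr -scalemxAl scalerA.
Qed.

(** The right-hand side at step [k+1] only reads the values at steps
    [0, ..., k], whence strong induction. *)
Lemma volterra_euler_unique (R : realType) (Omega : Type) (d : nat)
    (x0 : 'cV[R]_d) (b : 'cV[R]_d -> 'cV[R]_d) (sigma : 'cV[R]_d -> 'M[R]_d)
    (W : R -> Omega -> 'cV[R]_d) (T : R) (N : nat) (G1 G2 : R -> 'M[R]_d)
    (X X' : nat -> Omega -> 'cV[R]_d) :
  volterra_euler x0 b sigma W T N G1 G2 X ->
  volterra_euler x0 b sigma W T N G1 G2 X' ->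
  forall k, (k <= N)%N -> forall w, X k w = X' k w.
Proof.
move=> [X0 XS] [X'0 X'S] k lekN w.
elim/ltn_ind: k lekN => -[|k] IHk ltkN; first by rewrite X0 X'0.
have eqX (j : 'I_k.+1) : X j w = X' j w.
  by apply: IHk => //; apply: leq_trans (ltnW (ltn_ord j)) ltkN.
rewrite XS // X'S //.
by congr (_ + _ + _); apply: eq_bigr => j _; rewrite eqX.
Qed.

Lemma multifactor_euler_volterra (R : realType) (Omega : Type) (d n : nat)
    (x0 : 'cV[R]_d) (b : 'cV[R]_d -> 'cV[R]_d) (sigma : 'cV[R]_d -> 'M[R]_d)
    (W : R -> Omega -> 'cV[R]_d) (T : R) (N : nat) (alpha rho : 'I_n -> R)
    (M1 M2 G1 G2 : R -> 'M[R]_d) (Xf Yf : 'I_n -> nat -> Omega -> 'cV[R]_d)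
    (X : nat -> Omega -> 'cV[R]_d) :
  0 <= T ->
  (forall t, 0 <= t -> G1 t = exp_sum_kernel alpha rho M1 t) ->
  (forall t, 0 <= t -> G2 t = exp_sum_kernel alpha rho M2 t) ->
  multifactor_euler x0 b sigma W T N alpha rho M1 M2 Xf Yf X ->
  volterra_euler x0 b sigma W T N G1 G2 X.
Proof.
move=> T0 G1E G2E [F0 XfS YfS XE].
have t0 m : 0 <= m%:R * (T / N%:R) by rewrite mulr_ge0 ?divr_ge0.
split=> [w|k ltkN w].
  by rewrite XE // !big1 ?addr0 // => i _; have [Xf0 Yf0] := F0 i w;
    rewrite ?Xf0 ?Yf0 mulmx0 scaler0.
rewrite XE //.
rewrite (factor_sum_kernel alpha M1 (fun i => (F0 i w).1)
  (fun k ltkN i => XfS k ltkN i w) ltkN).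
rewrite (factor_sum_kernel alpha M2 (fun i => (F0 i w).2)
  (fun k ltkN i => YfS k ltkN i w) ltkN).
by congr (_ + _ + _); apply: eq_bigr => j _;
  rewrite ?G1E ?G2E // ?scalemxAr ?mulmxA.
Qed.

(** When the two kernels coincide, drift and noise can feed the same factor:
    the kernel acts linearly on their sum. *)
Lemma multifactor_euler_common_volterra (R : realType) (Omega : Type)
    (d n : nat) (x0 : 'cV[R]_d) (b : 'cV[R]_d -> 'cV[R]_d)
    (sigma : 'cV[R]_d -> 'M[R]_d) (W : R -> Omega -> 'cV[R]_d) (T : R)
    (N : nat) (alpha rho : 'I_n -> R) (M G1 G2 : R -> 'M[R]_d)
    (Xf : 'I_n -> nat -> Omega -> 'cV[R]_d) (X : nat -> Omega -> 'cV[R]_d) :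
  0 <= T ->
  (forall t, 0 <= t -> G1 t = exp_sum_kernel alpha rho M t) ->
  (forall t, 0 <= t -> G2 t = exp_sum_kernel alpha rho M t) ->
  multifactor_euler_common x0 b sigma W T N alpha rho M Xf X ->
  volterra_euler x0 b sigma W T N G1 G2 X.
Proof.
move=> T0 G1E G2E [F0 XfS XE].
have t0 m : 0 <= m%:R * (T / N%:R) by rewrite mulr_ge0 ?divr_ge0.
split=> [w|k ltkN w].
  by rewrite XE // big1 ?addr0 // => i _; rewrite F0 mulmx0 scaler0.
pose g j := (T / N%:R) *: b (X j w) + sigma (X j w) *m grid_increment T N W j w.
have FS j : (j < N)%N -> forall i,
    Xf i j.+1 w = expR (- (rho i * (T / N%:R))) *: (Xf i j w + g j).
  by move=> ltjN i; rewrite XfS // /g addrA.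
rewrite XE // (factor_sum_kernel alpha M (fun i => F0 i w) FS ltkN).
rewrite -addrA -big_split; congr (_ + _); apply: eq_bigr => j _.
by rewrite G1E // G2E // mulmxDr scalemxAr mulmxA.
Qed.

Theorem theorem4p2 (R : realType) (disp : measure_display)
    (Omega : measurableType disp) (P : probability Omega R)
    (d : nat) (hd : (1 <= d)%N) (x0 : 'cV[R]_d)
    (W : R -> Omega -> 'cV[R]_d) (hW : brownian_motion P W)
    (b : 'cV[R]_d -> 'cV[R]_d) (hb : lipschitz b)
    (sigma : 'cV[R]_d -> 'M[R]_d) (hsigma : lipschitz sigma)
    (M1 M2 M : R -> 'M[R]_d)
    (hM1 : bounded_measurable M1) (hM2 : bounded_measurable M2)
    (hM : bounded_measurable M)
    (n : nat) (hn : (1 <= n)%N) (alpha rho : 'I_n -> R)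
    (halpha : forall i, 0 <= alpha i)
    (hrho0 : forall i, 0 <= rho i)
    (hrho : forall i j : 'I_n, (i < j)%N -> rho i < rho j)
    (T : R) (hT : 0 < T) (N : nat) (hN : (1 <= N)%N) :
  (forall (G1 G2 : R -> 'M[R]_d) (X Xhat : nat -> Omega -> 'cV[R]_d)
      (Xf Yf : 'I_n -> nat -> Omega -> 'cV[R]_d),
    (forall t, 0 <= t -> G1 t = exp_sum_kernel alpha rho M1 t) ->
    (forall t, 0 <= t -> G2 t = exp_sum_kernel alpha rho M2 t) ->
    volterra_euler x0 b sigma W T N G1 G2 X ->
    multifactor_euler x0 b sigma W T N alpha rho M1 M2 Xf Yf Xhat ->
    forall k, (k <= N)%N -> forall w, X k w = Xhat k w)
  /\
  (forall (G1 G2 : R -> 'M[R]_d) (X Xhat : nat -> Omega -> 'cV[R]_d)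
      (Xf : 'I_n -> nat -> Omega -> 'cV[R]_d),
    (forall t, 0 <= t -> G1 t = exp_sum_kernel alpha rho M t) ->
    (forall t, 0 <= t -> G2 t = exp_sum_kernel alpha rho M t) ->
    volterra_euler x0 b sigma W T N G1 G2 X ->
    multifactor_euler_common x0 b sigma W T N alpha rho M Xf Xhat ->
    forall k, (k <= N)%N -> forall w, X k w = Xhat k w).
Proof.
split=> [G1 G2 X Xhat Xf Yf|G1 G2 X Xhat Xf] G1E G2E XV XhatM.
  apply: volterra_euler_unique XV _.
  exact: multifactor_euler_volterra (ltW hT) G1E G2E XhatM.
apply: volterra_euler_unique XV _.
exact: multifactor_euler_common_volterra (ltW hT) G1E G2E XhatM.
Qed.
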